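(* Let $\kappa$ be a regular infinite cardinal and $\mu$ a singular cardinal with $\mathrm{cf}(\mu)=\kappa$. Then $\mathrm{cov}(\mathcal M_\kappa({}^{\mu}2,\kappa))=\mathrm{cov}(\mathcal M_\kappa({}^{\mu}\kappa,\kappa))$, $\mathrm{add}(\mathcal M_\kappa({}^{\mu}2,\kappa))=\mathrm{add}(\mathcal M_\kappa({}^{\mu}\kappa,\kappa))$, $\mathrm{non}(\mathcal M_\kappa({}^{\mu}2,\kappa))=\mathrm{non}(\mathcal M_\kappa({}^{\mu}\kappa,\kappa))$, and $\mathrm{cof}(\mathcal M_\kappa({}^{\mu}2,\kappa))=\mathrm{cof}(\mathcal M_\kappa({}^{\mu}\kappa,\kappa))$.
   Context: For ordinals $\delta,\rho$, ${}^{\delta}\rho$ is the set of functions $\delta\to\rho$; for a partial function $s\colon\delta\rightharpoonup\rho$, $[s]=\{f\in{}^{\delta}\rho: s\subseteq f\}$. The ${<}\kappa$-box topology on ${}^{\delta}\rho$ has base $\{[s]: |\mathrm{dom}(s)|<\kappa\}$; $(X,\kappa)$ denotes $X$ with it. A set is $\kappa$-meagre if it is a union of at most $\kappa$ nowhere dense sets; $\mathcal M_\kappa(X,\tau)$ is the ideal of $\kappa$-meagre subsets of $(X,\tau)$. For a proper ideal $\mathcal I$ on $X$: $\mathrm{add}(\mathcal I)$ = least size of $A\subseteq\mathcal I$ with $\bigcup A\notin\mathcal I$; $\mathrm{cov}(\mathcal I)$ = least size of $C\subseteq\mathcal I$ with $\bigcup C=X$; $\mathrm{non}(\mathcal I)$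 = least size of $N\subseteq X$ with $N\notin\mathcal I$; $\mathrm{cof}(\mathcal I)$ = least size of $F\subseteq\mathcal I$ such that every $I\in\mathcal I$ is contained in some $J\in F$. *)

(* Defs.v *)
From mathcomp Require Import all_boot.
From mathcomp Require Import boolp classical_sets cardinality.
Set Implicit Arguments. Unset Strict Implicit. Unset Printing Implicit Defensive.
Local Open Scope classical_set_scope.
Local Open Scope card_scope.

(* Cardinals are represented by sets (and types, via [set: T]);
   comparison of cardinalities uses mathcomp-analysis' #<= and #=. *)

Definition card_lt T U (A : set T) (B : set U) := A #<= B /\ ~ (B #<= A).

Definition regular_infinite (K : Type) : Prop :=
  infinite_set [set: K] /\
  forall F : set (set K),
    card_lt F [set: K] -> (forall A, F A -> card_lt A [set: K]) ->
    \bigcup_(A in F) A <> [set: K].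

(* cf(mu) = kappa, i.e. kappa is the least number of sets of size < mu
   whose union is mu (the standard cardinal characterisation of the
   cofinality of an infinite cardinal). *)
Definition cofinality_is (M K : Type) : Prop :=
  (exists F : set (set M),
      F #= [set: K] /\ (forall A, F A -> card_lt A [set: M]) /\
      \bigcup_(A in F) A = [set: M]) /\
  (forall F : set (set M),
      card_lt F [set: K] -> (forall A, F A -> card_lt A [set: M]) ->
      \bigcup_(A in F) A <> [set: M]).

Definition singular_with_cof (M K : Type) : Prop :=
  cofinality_is M K /\ card_lt [set: K] [set: M].

(* basic open set [s] for the partial function s with domain D, |D| < kappa *)
Definition box_basic (M R K : Type) (U : set (M -> R)) : Prop :=
  exists (D : set M) (s : M -> R),
    card_lt D [set: K] /\ U = [set f | forall x, D x -> f x = s x].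

Definition box_open (M R K : Type) (U : set (M -> R)) : Prop :=
  forall f, U f -> exists B, box_basic K B /\ B f /\ B `<=` U.

Definition box_interior (M R K : Type) (A : set (M -> R)) : set (M -> R) :=
  [set f | exists U, box_open K U /\ U f /\ U `<=` A].

Definition box_closure (M R K : Type) (A : set (M -> R)) : set (M -> R) :=
  [set f | forall U, box_open K U -> U f -> U `&` A !=set0].

Definition box_nowhere_dense (M R K : Type) (A : set (M -> R)) : Prop :=
  box_interior K (box_closure K A) = set0.

Definition kappa_meagre (M R K : Type) (A : set (M -> R)) : Prop :=
  exists F : set (set (M -> R)),
    F #<= [set: K] /\ (forall B, F B -> box_nowhere_dense K B) /\
    A = \bigcup_(B in F) B.

(* ---- Cardinal characteristics of an ideal I on X.
   [is_add I L] says add(I) = |L|, etc. (|L| is the least size of a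
   witness family). ---- *)

Definition is_add (X L : Type) (I : set X -> Prop) : Prop :=
  (exists A : set (set X), A #= [set: L] /\ (forall B, A B -> I B) /\
     ~ I (\bigcup_(B in A) B)) /\
  (forall A : set (set X), (forall B, A B -> I B) ->
     ~ I (\bigcup_(B in A) B) -> [set: L] #<= A).

Definition is_cov (X L : Type) (I : set X -> Prop) : Prop :=
  (exists C : set (set X), C #= [set: L] /\ (forall B, C B -> I B) /\
     \bigcup_(B in C) B = [set: X]) /\
  (forall C : set (set X), (forall B, C B -> I B) ->
     \bigcup_(B in C) B = [set: X] -> [set: L] #<= C).

Definition is_non (X L : Type) (I : set X -> Prop) : Prop :=
  (exists N : set X, N #= [set: L] /\ ~ I N) /\
  (forall N : set X, ~ I N -> [set: L] #<= N).

Definition is_cof (X L : Type) (I : set X -> Prop) : Prop :=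
  (exists F : set (set X), F #= [set: L] /\ (forall B, F B -> I B) /\
     (forall J, I J -> exists2 J', F J' & J `<=` J')) /\
  (forall F : set (set X), (forall B, F B -> I B) ->
     (forall J, I J -> exists2 J', F J' & J `<=` J') -> [set: L] #<= F).

(* Main.v *)
From Stdlib Require Import Inverse_Image.
Require Import Defs.
From mathcomp Require Import all_boot.
From mathcomp Require Import boolp classical_sets functions cardinality wochoice.
Set Implicit Arguments. Unset Strict Implicit. Unset Printing Implicit Defensive.
Local Open Scope classical_set_scope.
Local Open Scope card_scope.

(* A bijection between two spaces which, in both directions, maps every basic open
   set onto a superset of some basic open set preserves nowhere dense sets, hence the
   ideal of kappa-meagre sets and all its cardinal characteristics.  Call such a
   bijection a feeble homeomorphism; it exists between ^mu 2 and ^mu kappa: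
     ^mu 2 = ^(mu * kappa) 2 = ^mu (^kappa 2) ~ ^mu (kappa * ^kappa 2)
           = ^mu kappa * ^(mu * kappa) 2 = ^mu kappa * ^mu 2 = ^mu (kappa * 2) = ^mu kappa,
   where kappa is discrete.  The only step which is not a homeomorphism is
   ^kappa 2 ~ kappa * ^kappa 2: it sends x to the position of its first 1 together
   with the part of x after it.  The sequences with at most one 1 are nowhere dense,
   as are the pairs (a, 0); both sets have size kappa, and they are matched by a
   bijection. *)

(** * Comparison of cardinalities, and well-orderings *)

Lemma card_le_rel T U (A : set T) (B : set U) (R : T -> U -> Prop) :
  (forall x, A x -> exists2 y, B y & R x y) ->
  (forall x x' y, A x -> A x' -> R x y -> R x' y -> x = x') -> A #<= B.
Proof.
(* [pcard_leP] and the default value of the chosen function need a pointed codomain, so the empty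
   codomain is treated apart. *)
elim/Ppointed: U => U in B R * => RP Rinj.
  suff -> : A = set0 by [].
  by rewrite -subset0 => x /RP[y]; have := no y.
have /choice[f fP] : forall x, exists y, A x -> B y /\ R x y.
  move=> x; have [/RP[y By Rxy]|nAx] := pselect (A x); first by exists y.
  by exists point => /nAx.
apply/pcard_leP/injfunPex; exists f; first by move=> x /fP[].
move=> x x' /set_mem Ax /set_mem Ax' ff'; apply: (Rinj _ _ (f x)) => //.
  exact: (fP _ Ax).2.
by rewrite ff'; exact: (fP _ Ax').2.
Qed.

Lemma card_le_inj T U (f : T -> U) (A : set T) (B : set U) :
  (forall x, A x -> B (f x)) ->
  (forall x x', A x -> A x' -> f x = f x' -> x = x') -> A #<= B.
Proof.
move=> AB finj; apply: (@card_le_rel _ _ _ _ (fun x y => f x = y)).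
  by move=> x /AB; exists (f x).
by move=> x x' y Ax Ax' <- /esym; exact: finj.
Qed.

Lemma card_le_ex T U (u : U) (A : set T) (B : set U) : A #<= B ->
  exists f : T -> U, (forall x, A x -> B (f x)) /\
    (forall x x', A x -> A x' -> f x = f x' -> x = x').
Proof.
elim/Ppointed: U => U in u B *; first by have := no u.
move=> /pcard_leP/injfunPex[f fAB finj]; exists f; split=> // x x' Ax Ax'.
by apply: finj; exact: mem_set.
Qed.

Lemma card_eqTP T U : [set: T] #= [set: U] ->
  exists (f : T -> U) (g : U -> T), cancel f g /\ cancel g f.
Proof.
elim/Ppointed: U => U.
  move=> /card_bijP[f _]; have F (x : T) : False.
    by have := no (val (f (SigSub (mem_set (I : [set: T] x))))).
  by exists (fun x => False_rect U (F x)), (fun y => False_rect T (no y)); split=> z;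
    [have := F z | have := no z].
move=> /card_set_bijP[f [_ finj fsurj]].
have /choice[g gP] : forall y, exists x, f x = y.
  by move=> y; have [x _ <-] := fsurj y I; exists x.
by exists f, g; split=> // x; apply: finj; rewrite ?in_setT.
Qed.

Lemma card_eq_setT T U (t0 : T) (u0 : U) (A : set U) : [set: T] #= A ->
  exists (r : T -> U) (s : U -> T),
    [/\ forall t, A (r t), cancel r s & forall u, A u -> r (s u) = u].
Proof.
elim/Ppointed: U => U in u0 A *; first by have := no u0.
move=> /card_set_bijP[r [rA rinj rsurj]].
have /choice[s sP] : forall u, exists t, A u -> r t = u.
  move=> u; have [/rsurj[t _ <-]|nAu] := pselect (A u); first by exists t.
  by exists t0 => /nAu.
exists r, s; split=> [t|t|u /sP//]; first exact: rA.
by apply: rinj; rewrite ?in_setT // sP //; exact: rA.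
Qed.

(** Zorn's lemma gives a maximal partial injection from [A] to [B]. The pair [(x, y)] is represented
    by the set of [inl x] and [inr y], so that disjoint families of pairs are exactly the graphs of
    partial injections. If both a point of [A] and a point of [B] were missed, this pair could be
    added. *)
Lemma card_le_total T U (A : set T) (B : set U) : A #<= B \/ B #<= A.
Proof.
pose F (p : T * U) := [set inl p.1; inr p.2] : set (T + U).
have [G [GAB tG Gmax]] := @ex_maximal_disjoint_subcollection _ _ F (A `*` B).
pose dom := [set x | exists y, G (x, y)]; pose ran := [set y | exists x, G (x, y)].
have [sA|/existsNP[a /not_implyP[Aa na]]] := pselect (A `<=` dom).
  left; apply: (@card_le_rel _ _ _ _ (fun x y => G (x, y))).
    by move=> x /sA[y Gxy]; exists y => //; exact: (GAB _ Gxy).2.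
  move=> x x' y _ _ Gx Gx'; suff [] : (x, y) = (x', y) by [].
  by apply: tG => //; exists (inr y); split; right.
have [sB|/existsNP[b /not_implyP[Bb nb]]] := pselect (B `<=` ran).
  right; apply: (@card_le_rel _ _ _ _ (fun y x => G (x, y))).
    by move=> y /sB[x Gxy]; exists x => //; exact: (GAB _ Gxy).1.
  move=> x x' y _ _ Gx Gx'; suff [] : (y, x) = (y, x') by [].
  by apply: tG => //; exists (inl y); split; left.
have {}na y : ~ G (a, y) by move=> ?; apply: na; exists y.
have {}nb x : ~ G (x, b) by move=> ?; apply: nb; exists x.
case: (Gmax (G `|` [set (a, b)])).
- by split=> [p|]; [left | move=> /(_ (a, b) (or_intror erefl))/na].
- by move=> p [/GAB//|->].
- move=> [x y] [x' y'] [G1|[-> ->]] [G2|[-> ->]] //.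
  + exact: tG.
  + by move=> [z [[->|->] [[]|[]]]] // e; subst; [case: (na y) | case: (nb x)].
  + by move=> [z [[->|->] [[]|[]]]] // e; subst; [case: (na y') | case: (nb x')].
Qed.

Lemma card_ltP T U (A : set T) (B : set U) : card_lt A B <-> ~ (B #<= A).
Proof. by split=> [[]//|nBA]; split=> //; case: (card_le_total A B). Qed.

Lemma card_le_lt T U V (A : set T) (B : set U) (C : set V) :
  A #<= B -> card_lt B C -> card_lt A C.
Proof.
move=> AB /card_ltP nCB; apply/card_ltP; apply: contra_not nCB => CA.
exact: card_le_trans CA AB.
Qed.

Lemma card_le_setXT T T' U U' (u : U) (u' : U') :
  [set: T] #<= [set: U] -> [set: T'] #<= [set: U'] ->
  [set: T * T'] #<= [set: U * U'].
Proof.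
move=> /(card_le_ex u)[f [_ fi]] /(card_le_ex u')[g [_ gi]].
apply: (@card_le_inj _ _ (fun p => (f p.1, g p.2))) => // -[a b] [c d] _ _ /=.
by move=> [/fi-> // /gi->].
Qed.

(** The strict part of a Zermelo well-ordering. Totality and antisymmetry come from the unique
    minimum of a pair, transitivity from the minimum of a triple. *)
Lemma wf_total_order (T : Type) : exists lt : T -> T -> Prop,
  [/\ well_founded lt, (forall x y z, lt x y -> lt y z -> lt x z),
      (forall x, ~ lt x x) & (forall x y, [\/ lt x y, x = y | lt y x])].
Proof.
elim/Peq : T => T.
have [R Rwo] := well_ordering_principle T.
have tot x y : R x y \/ R y x.
  have [|z [[/orP[] /eqP -> lz] _]] := Rwo [pred t | (t == x) || (t == y)].
  - by exists x; rewrite inE eqxx.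
  - by left; apply: lz; rewrite inE eqxx orbT.
  - by right; apply: lz; rewrite inE eqxx.
have refl x : R x x by case: (tot x x).
have anti x y : R x y -> R y x -> x = y.
  move=> xy yx; have [|z [_ uz]] := Rwo [pred t | (t == x) || (t == y)].
    by exists x; rewrite inE eqxx.
  have <- : z = x by apply: uz; split=> [|t /orP[] /eqP ->] //; rewrite inE eqxx.
  by apply: uz; split=> [|t /orP[] /eqP ->] //; rewrite inE eqxx orbT.
have trans x y z : R x y -> R y z -> R x z.
  move=> xy yz.
  have [|w [[+ lw] _]] := Rwo [pred t | [|| t == x, t == y | t == z]].
    by exists x; rewrite inE eqxx.
  have lx : R w x by apply: lw; rewrite inE eqxx.
  have ly : R w y by apply: lw; rewrite inE eqxx orbT.
  have lz : R w z by apply: lw; rewrite inE eqxx !orbT.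
  move=> /or3P[] /eqP e; subst w => //; first by rewrite (anti x y).
  by rewrite (anti x y) // (anti y z).
exists (fun x y => R x y /\ x <> y); split.
- move=> x; apply: contrapT => nAx.
  have [|z [[/asboolP nAz lz] _]] := Rwo [pred t | `[< ~ Acc (fun x y => R x y /\ x <> y) t >]].
    by exists x; apply/asboolP.
  apply: nAz; constructor=> y [yz neq]; apply: contrapT => nAy; apply: neq.
  by apply: anti => //; apply: lz; apply/asboolP.
- move=> x y z [xy nxy] [yz nyz]; split; first exact: trans yz.
  by move=> e; subst z; apply: nxy; exact: anti.
- by move=> x [].
- move=> x y; have [->|nxy] := pselect (x = y); first by constructor 2.
  by case: (tot x y) => ?; [constructor 1 | constructor 3; split => // /esym].
Qed.

(** * Arithmetic of a regular cardinal *)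

Lemma infinite_card_lt1 (K T : Type) (x : T) :
  infinite_set [set: K] -> card_lt [set x] [set: K].
Proof.
move=> Kinf; apply/card_ltP; apply: contra_not Kinf => /card_le_finite.
by apply; exact: finite_set1.
Qed.

Lemma infinite_card_lt_finite (K T : Type) (A : set T) :
  infinite_set [set: K] -> finite_set A -> card_lt A [set: K].
Proof.
by move=> Kinf fA; apply/card_ltP; apply: contra_not Kinf => /card_le_finite; apply.
Qed.

(** An injection of [K] into the union would pull the sets [E i] back to a cover of [K] by fewer
    than |K| sets of size below |K|, against regularity. *)
Lemma regular_bigcup (K I T : Type) (D : set I) (E : I -> set T) :
  regular_infinite K -> card_lt D [set: K] ->
  (forall i, D i -> card_lt (E i) [set: K]) ->
  card_lt (\bigcup_(i in D) E i) [set: K].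
Proof.
move=> [Kinf Kreg] Dlt Elt; apply/card_ltP => KE.
have [[i [t [Di Eit]]]|nE] := pselect (exists i t, D i /\ E i t); last first.
  have /card_le0P K0 : [set: K] #<= (@set0 T).
    suff <- : \bigcup_(i in D) E i = set0 by [].
    by rewrite -subset0 => t [i Di Eit]; apply: nE; exists i, t.
  by apply: Kinf; rewrite K0; exact: finite_set0.
have [f [fE finj]] := card_le_ex t KE.
apply: (Kreg [set f @^-1` E i | i in D]).
- exact: card_le_lt (card_image_le _ _) Dlt.
- move=> _ [j Dj <-]; apply: card_le_lt (Elt j Dj).
  by apply: (@card_le_inj _ _ f) => // x x' _ _; exact: finj.
- rewrite -subTset => k _; have [j Dj Ejk] := fE k Logic.I.
  by exists (f @^-1` E j) => //; exists j.
Qed.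

Lemma regular_setU (K T : Type) (A B : set T) :
  regular_infinite K -> card_lt A [set: K] -> card_lt B [set: K] ->
  card_lt (A `|` B) [set: K].
Proof.
move=> Kreg Alt Blt.
have -> : A `|` B = \bigcup_(b in [set: bool]) (if b then A else B).
  apply/seteqP; split=> x; first by case; [exists true | exists false].
  by move=> [[] _ ?]; [left | right].
apply: regular_bigcup => //; last by case.
by apply: infinite_card_lt_finite Kreg.1 _; exact: finite_finset.
Qed.

Lemma card_lt_exN (K : Type) (D : set K) : card_lt D [set: K] -> exists d, ~ D d.
Proof.
move=> /card_ltP nKD; apply/existsNP => DT; apply: nKD.
by apply: subset_card_le => x _; exact: DT.
Qed.

Lemma regular_setC (K : Type) (D : set K) :
  regular_infinite K -> card_lt D [set: K] -> [set: K] #<= ~` D.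
Proof.
move=> Kreg Dlt; apply: contrapT => /card_ltP CDlt.
have /card_ltP := regular_setU Kreg Dlt CDlt.
by rewrite setUv; apply; exact: card_lexx.
Qed.

(** This is a well-order of type the initial ordinal of |K|. If some initial segment is not small,
    take the least [a] with such a segment, inject [K] into the segment below [a] and pull the order
    back. The new segments embed into segments below points smaller than [a], which are small. *)
Lemma regular_order (K : Type) : regular_infinite K -> exists lt : K -> K -> Prop,
  [/\ well_founded lt, (forall x y z, lt x y -> lt y z -> lt x z),
      (forall x, ~ lt x x), (forall x y, [\/ lt x y, x = y | lt y x]) &
      forall x, card_lt [set y | lt y x] [set: K]].
Proof.
move=> Kreg; have [lt [ltwf lttr ltirr lttot]] := wf_total_order K.
have [sm|/existsNP[x0 nx0]] := pselect (forall x, card_lt [set y | lt y x] [set: K]).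
  by exists lt.
elim: (ltwf x0) nx0 => a _ IH na.
have [[b [ba nb]]|smb] := pselect (exists b, lt b a /\ ~ card_lt [set y | lt y b] [set: K]).
  exact: IH ba nb.
have Ka : [set: K] #<= [set y | lt y a] by apply: contrapT => /card_ltP.
have [f [fa finj]] := card_le_ex a Ka.
exists (fun x y => lt (f x) (f y)); split.
- exact: (wf_inverse_image _ _ lt f).
- by move=> x y z; exact: lttr.
- by move=> x; exact: ltirr.
- move=> x y; case: (lttot (f x) (f y)) => [?|/finj ->//|?]; first by constructor 1.
    by constructor 2.
  by constructor 3.
- move=> x; have /contrapT sx : ~ ~ card_lt [set y | lt y (f x)] [set: K].
    by move=> ns; apply: smb; exists (f x); split=> //; exact: fa.
  apply: card_le_lt sx.
  by apply: (@card_le_inj _ _ f) => // u v _ _; exact: finj.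
Qed.

(* The rank function of a well-founded total order with small initial segments is injective. *)
Lemma regular_rank (K T : Type) (lt : T -> T -> Prop) :
  well_founded lt -> (forall x y, [\/ lt x y, x = y | lt y x]) ->
  (forall x, card_lt [set y | lt y x] [set: K]) -> [set: T] #<= [set: K].
Proof.
move=> ltwf lttot ltsm.
pose F x (g : forall y, lt y x -> K) := [set k | exists y (h : lt y x), k = g y h].
have Fsm x g : card_lt (@F x g) [set: K].
  apply: card_le_lt (ltsm x).
  apply: (@card_le_rel _ _ _ _ (fun k y => exists h : lt y x, k = g y h)).
    by move=> k [y [h ->]]; exists y => //; exists h.
  by move=> k k' y _ _ [h ->] [h' ->]; rewrite (Prop_irrelevance h h').
(* The rank of [x] is any point of [K] not taken by its predecessors; one exists because [x] has
   fewer than |K| of them. *)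
pose step x g := projT1 (cid (card_lt_exN (Fsm x g))).
pose r := Fix ltwf (fun=> K) step.
have rE x : r x = step x (fun y _ => r y).
  apply: (Fix_eq _ (fun=> K)) => {}x g g' gg'; congr step.
  by apply: functional_extensionality_dep => y; apply: funext => h.
have rlt x y : lt x y -> r x <> r y.
  move=> xy; rewrite [r y]rE /step; case: cid => d /= nd e; apply: nd.
  by exists x, xy; rewrite e.
apply: (@card_le_inj _ _ r) => // x y _ _ e.
by case: (lttot x y) => // /rlt; rewrite e.
Qed.

(** The Goedel ordering: pairs are compared by their maximum [m] first, ties being broken by an
    arbitrary well-order [lt0]. The predecessors of [q] lie in the square of the points up to [m q],
    and regularity makes this square small, in place of an induction over smaller cardinals. *)
Lemma regular_card_prod (K : Type) : regular_infinite K -> [set: K * K] #<= [set: K].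
Proof.
move=> Kreg; have [lt [ltwf lttr _ lttot ltsm]] := regular_order Kreg.
have [lt0 [lt0wf _ _ lt0tot]] := wf_total_order (K * K).
pose m (p : K * K) := if pselect (lt p.1 p.2) then p.2 else p.1.
apply: (@regular_rank K _ (fun p q => lt (m p) (m q) \/ m p = m q /\ lt0 p q)).
(* Lexicographic induction: the outer one on the value of [m], the inner one on [lt0]. *)
- move=> p; move: {2}(m p) (erefl (m p)) => a; elim: (ltwf a) p => {}a _ IHa p.
  elim: (lt0wf p) => {}p _ IHp pa; constructor=> q [qp|[qp qp0]].
    by apply: IHa (erefl _); rewrite -pa.
  by apply: IHp => //; rewrite qp.
- move=> p q; case: (lttot (m p) (m q)) => [?|e|?].
  + by constructor 1; left.
  + case: (lt0tot p q) => ?; [constructor 1|constructor 2|constructor 3] => //; right => //.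
  + by constructor 3; left.
- move=> q.
  have smq : card_lt ([set y | lt y (m q)] `|` [set m q]) [set: K].
    by apply: regular_setU => //; exact: infinite_card_lt1 Kreg.1.
  apply: (@card_le_lt _ _ _ _ (\bigcup_(x in [set y | lt y (m q)] `|` [set m q])
    [set p | p.1 = x /\ ([set y | lt y (m q)] `|` [set m q]) p.2])).
    apply: subset_card_le => p mp.
    have {}mp : lt (m p) (m q) \/ m p = m q by case: mp => [|[]]; [left|right].
    have le1 : lt p.1 (m p) \/ p.1 = m p by rewrite /m; case: pselect => ? /=; [left|right].
    have le2 : lt p.2 (m p) \/ p.2 = m p.
      rewrite /m; case: pselect => [lt12|n12] /=; first by right.
      by case: (lttot p.1 p.2) => // ?; [right | left].
    have le x : lt x (m p) \/ x = m p -> ([set y | lt y (m q)] `|` [set m q]) x.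
      move=> [xp|->]; last by case: mp; [left | right].
      by left; case: mp => [/(lttr _ _ _ xp)//|<-].
    by exists p.1; [exact: le | split=> //; exact: le].
  apply: regular_bigcup => // x _; apply: card_le_lt smq.
  apply: (@card_le_inj _ _ snd); first by move=> p [].
  by move=> [a b] [c d] [/= -> _] [/= -> _] ->.
Qed.

Lemma regular_card_prod_bool (K : Type) :
  regular_infinite K -> [set: K * bool] #<= [set: K].
Proof.
move=> Kreg; have [k0 _] := infinite_setN0 Kreg.1.
apply: card_le_trans (regular_card_prod Kreg); apply: card_le_setXT => //.
by apply: (infinite_card_lt_finite Kreg.1 _).1; exact: finite_finset.
Qed.

Lemma regular_card_option (K : Type) :
  regular_infinite K -> [set: option K] #<= [set: K].
Proof.
move=> Kreg; have [k0 _] := infinite_setN0 Kreg.1.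
apply: card_le_trans (regular_card_prod_bool Kreg).
apply: (@card_le_inj _ _ (fun o => if o is Some k then (k, true) else (k0, false))) => //.
by move=> [x|] [y|] _ _ //= [->].
Qed.

(* A maximal disjoint family of injections K -> M covers M up to fewer than |K| points. *)
Lemma regular_card_prodr (K M : Type) : regular_infinite K ->
  [set: K] #<= [set: M] -> [set: M * K] #<= [set: M].
Proof.
move=> Kreg KM; have [k0 _] := infinite_setN0 Kreg.1.
have [G [Ginj tG Gmax]] := @ex_maximal_disjoint_subcollection _ _
  (fun g : K -> M => range g) [set g | injective g].
pose L := [set m | forall g k, G g -> g k <> m].
(* Otherwise an injection of [K] into the uncovered set [L] could be added to [G]. *)
have Llt : card_lt L [set: K].
  apply/card_ltP => KL.
  have [m0 _] : exists m : M, True.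
    by have /card_leP[h] := KM; exists (val (h (SigSub (mem_set (Logic.I : [set: K] k0))))).
  have [h [hL hinj]] := card_le_ex m0 KL.
  have nh g k k' : G g -> g k <> h k' by exact: hL.
  apply: (Gmax (G `|` [set h])).
  - split=> [g|/(_ h (or_intror erefl)) Gh]; first by left.
    exact: (nh h k0 k0).
  - by move=> g [/Ginj//|->] x y; exact: hinj.
  - move=> g g' [Gg|->] [Gg'|->] //.
    + exact: tG.
    + by move=> [z [[k _ <-] [k' _ /esym/nh]]].
    + by move=> [z [[k _ <-] [k' _ /nh]]].
have [g0 Gg0] : exists g, G g.
  apply: contrapT => nG; have /card_ltP := Llt; apply.
  suff -> : L = [set: M] by [].
  by rewrite -subTset => m _ g k Gg; case: nG; exists g.
have [h [_ hinj]] := card_le_ex k0 Llt.1.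
have [j [_ jinj]] : exists j : (K * bool) * K -> K, (forall x, [set: _] x -> [set: K] (j x)) /\
    (forall x x', [set: _] x -> [set: _] x' -> j x = j x' -> x = x').
  apply: card_le_ex => //; apply: card_le_trans (regular_card_prod Kreg).
  by apply: card_le_setXT => //; exact: regular_card_prod_bool.
(* Each [m] receives a member [g] of the family and a code [c]: its position on [g] with tag [true],
   or, if [m] is left over, the label [h m] with tag [false] on the fixed host [g0]. Since [j] packs
   [(c, k)] into [K], the pair [(m, k)] can be sent to [g (j (c, k))]. *)
pose code (g : K -> M) m c :=
  (exists2 k, m = g k & c = (k, true)) \/ [/\ g = g0, L m & c = (h m, false)].
apply: (@card_le_rel _ _ _ _ (fun p m' =>
  exists g c, [/\ G g, code g p.1 c & m' = g (j (c, p.2))])).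
  move=> [m k] _.
  have [[g [k' [Gg e]]]|nm] := pselect (exists g k', G g /\ g k' = m).
    by exists (g (j ((k', true), k))) => //; exists g, (k', true); split=> //; left; exists k'.
  exists (g0 (j ((h m, false), k))) => //; exists g0, (h m, false); split=> //; right; split=> //.
  by move=> g k' Gg e; apply: nm; exists g, k'.
move=> [m k] [m' k'] n _ _ [g [c [Gg cg ->]]] [g' [c' [Gg' cg' /= e]]].
have gg' : g = g'.
  by apply: tG => //; exists (g (j (c, k))); split; [exists (j (c, k)) | rewrite e; exists (j (c', k'))].
subst g'; have [] := jinj _ _ Logic.I Logic.I (Ginj _ Gg _ _ e) => ec ->; subst c'; congr pair.
move: cg cg' => /= [[k1 -> ->]|[_ Lm ->]] [[k2 -> // []]|[_ Lm' []]] //.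
- by move=> ->.
- by move/hinj; apply.
Qed.

(** * Feeble homeomorphisms *)

(* The base is only used as a pi-base: it need not cover the space. *)
Record bspace := BSpace { carrier :> Type; base : set (set carrier) }.

Definition discrete (R : Type) : bspace := @BSpace R (range (fun r => [set r])).

Definition bprod (X Y : bspace) : bspace := @BSpace (X * Y)
  [set U | exists B C, [/\ base B, base C & U = B `*` C]].

Definition box (K M : Type) (X : bspace) : bspace := @BSpace (M -> X)
  [set U | exists (D : set M) (b : M -> set X),
    [/\ card_lt D [set: K], forall i, D i -> base (b i) &
        U = [set f | forall i, D i -> b i (f i)]]].

(** Nowhere density is phrased through the base alone so that it can be moved along feeble
    homeomorphisms; [box_nowhere_denseE] links it to the definition by closure and interior. *)
Definition nwd (X : bspace) (A : set X) : Prop :=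
  forall B : set X, base B -> exists2 B' : set X, base B' & B' `<=` B `\` A.

(** The image of [B] under [f] is written as its preimage under the inverse [g], and symmetrically
    for [C]. *)
Definition feeble_inverses (X Y : bspace) (f : X -> Y) (g : Y -> X) : Prop :=
  [/\ cancel f g, cancel g f,
      forall B : set X, base B -> exists2 C : set Y, base C & C `<=` g @^-1` B &
      forall C : set Y, base C -> exists2 B : set X, base B & B `<=` f @^-1` C].

Definition feebly_homeomorphic (X Y : bspace) : Prop :=
  exists (f : X -> Y) (g : Y -> X), feeble_inverses f g.

Lemma feeble_inversesC (X Y : bspace) (f : X -> Y) (g : Y -> X) :
  feeble_inverses f g -> feeble_inverses g f.
Proof. by case. Qed.

Lemma feebly_homeomorphic_sym (X Y : bspace) :
  feebly_homeomorphic X Y -> feebly_homeomorphic Y X.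
Proof. by move=> [f [g /feeble_inversesC]]; exists g, f. Qed.

Lemma feebly_homeomorphic_trans (Y X Z : bspace) :
  feebly_homeomorphic X Y -> feebly_homeomorphic Y Z -> feebly_homeomorphic X Z.
Proof.
move=> [f [g [fg gf Xg Yf]]] [f' [g' [fg' gf' Yg' Zf']]].
exists (f' \o f), (g \o g'); split; [exact: can_comp|exact: can_comp| |].
- move=> B /Xg[C /Yg'[E Eb EC] CB]; exists E => // z /EC; exact: CB.
- move=> E /Zf'[C /Yf[B Bb BC] CE]; exists B => // x /BC; exact: CE.
Qed.

(** From a base set of [X] one passes to a base set of [Y] inside its image, shrinks that one to
    miss [A], and returns to a base set of [X]. *)
Lemma feeble_inverses_nwd (X Y : bspace) (f : X -> Y) (g : Y -> X) (A : set Y) :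
  feeble_inverses f g -> nwd A -> nwd (f @^-1` A).
Proof.
move=> [fg gf Xg Yf] An B /Xg[C /An[C' /Yf[B' B'b B'C'] C'C] CB].
by exists B' => // x /B'C' /C'C [/CB]; rewrite /= fg.
Qed.

(** * Discrete spaces, products and boxes up to feeble homeomorphism *)

Lemma discrete_bij (R S : Type) (f : R -> S) (g : S -> R) :
  cancel f g -> cancel g f -> @feeble_inverses (discrete R) (discrete S) f g.
Proof.
move=> fg gf; split=> // _ [r _ <-].
  by exists [set f r]; [exists (f r) | move=> _ ->; exact: fg].
by exists [set g r]; [exists (g r) | move=> _ ->; exact: gf].
Qed.

Lemma discrete_prod (R S : Type) :
  feebly_homeomorphic (bprod (discrete R) (discrete S)) (discrete (R * S)%type).
Proof.
exists id, id; split=> //.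
- by move=> _ [_ [_ [[r _ <-] [s _ <-] ->]]]; exists [set (r, s)]; [exists (r, s) | move=> _ ->].
- move=> _ [[r s] _ <-]; exists ([set r] `*` [set s]); last by move=> [? ?] [/= -> ->].
  by exists [set r], [set s]; split=> //; [exists r | exists s].
Qed.

Lemma bprod_feeble (X X' Y Y' : bspace) :
  feebly_homeomorphic X X' -> feebly_homeomorphic Y Y' ->
  feebly_homeomorphic (bprod X Y) (bprod X' Y').
Proof.
move=> [f [g [fg gf Xg Yf]]] [f' [g' [fg' gf' Xg' Yf']]].
exists (fun p => (f p.1, f' p.2)), (fun p => (g p.1, g' p.2)); split.
- by move=> [x y] /=; rewrite fg fg'.
- by move=> [x y] /=; rewrite gf gf'.
- move=> _ [B [C [/Xg[B' B'b BB'] /Xg'[C' C'b CC'] ->]]].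
  by exists (B' `*` C'); [exists B', C' | move=> p [/BB' ? /CC']].
- move=> _ [B [C [/Yf[B' B'b BB'] /Yf'[C' C'b CC'] ->]]].
  by exists (B' `*` C'); [exists B', C' | move=> p [/BB' ? /CC']].
Qed.

Lemma feebly_homeomorphic_refl (X : bspace) : feebly_homeomorphic X X.
Proof. by exists id, id; split=> // B; exists B. Qed.

Lemma box_feeble (K M : Type) (X Y : bspace) :
  feebly_homeomorphic X Y -> feebly_homeomorphic (box K M X) (box K M Y).
Proof.
move=> [f [g fgP]]; exists (fun x i => f (x i)), (fun y i => g (y i)).
have H (X' Y' : bspace) (f' : X' -> Y') (g' : Y' -> X') : feeble_inverses f' g' ->
    forall B : set (box K M X'), base B ->
    exists2 C : set (box K M Y'), base C & C `<=` [set y | B (fun i => g' (y i))].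
  move=> [_ _ Xg _] _ [D [b [Dlt bb ->]]].
  have /choice[c cP] : forall i, exists c, D i -> base c /\ c `<=` g' @^-1` b i.
    move=> i; have [/bb/Xg[c cb cP]|nDi] := pselect (D i); first by exists c.
    by exists set0 => /nDi.
  exists [set y | forall i, D i -> c i (y i)].
    by exists D, c; split=> // i /cP[].
  by move=> y yc i Di; apply: (cP i Di).2; exact: yc.
split; [| |exact: (H _ _ _ _ fgP)|exact: (H _ _ _ _ (feeble_inversesC fgP))].
  by case: fgP => fg _ _ _ x; apply: funext => i; exact: fg.
by case: fgP => _ gf _ _ x; apply: funext => i; exact: gf.
Qed.

Lemma box_reindex (K M N : Type) (X : bspace) : [set: M] #= [set: N] ->
  feebly_homeomorphic (box K M X) (box K N X).
Proof.
move=> /card_eqTP[u [v [uv vu]]]; exists (fun x n => x (v n)), (fun y m => y (u m)).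
have H M' N' (u' : M' -> N') (v' : N' -> M') : cancel u' v' -> cancel v' u' ->
    forall B : set (box K M' X), base B ->
    exists2 C : set (box K N' X), base C & C `<=` [set y | B (fun m => y (u' m))].
  move=> uv' vu' _ [D [b [Dlt bb ->]]].
  exists [set y | forall n, (v' @^-1` D) n -> b (v' n) (y n)].
    exists (v' @^-1` D), (b \o v'); split=> // [|n /bb//].
    apply: card_le_lt Dlt; apply: (@card_le_inj _ _ v') => // n n' _ _.
    exact: (can_inj vu').
  by move=> y yb m Dm; have := yb (u' m); rewrite /= uv'; apply.
split; [| |exact: H|exact: H].
  by move=> x; apply: funext => m; rewrite uv.
by move=> x; apply: funext => m; rewrite vu.
Qed.

(** Two boxes with supports [D] and [E] must be merged into one with support their union. On
    coordinates where only one of them imposes a condition, [B0] or [C0] serves as the other factor,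
    whence the nonempty bases. *)
Lemma box_prod (K M : Type) (X Y : bspace) : regular_infinite K ->
  (exists B : set X, base B) -> (exists C : set Y, base C) ->
  feebly_homeomorphic (box K M (bprod X Y)) (bprod (box K M X) (box K M Y)).
Proof.
move=> Kreg [B0 B0b] [C0 C0b].
exists (fun f => (fun i => (f i).1, fun i => (f i).2)), (fun p i => (p.1 i, p.2 i)).
split=> //.
- by move=> f; apply: funext => i /=; case: (f i).
- by case.
- move=> _ [D [b [Dlt bb ->]]].
  have /choice[c cP] : forall i, exists c : set X * set Y,
      D i -> [/\ base c.1, base c.2 & b i = c.1 `*` c.2].
    move=> i; have [/bb[B [C ?]]|nDi] := pselect (D i); first by exists (B, C).
    by exists (set0, set0) => /nDi.
  exists ([set f | forall i, D i -> (c i).1 (f i)] `*`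
          [set f | forall i, D i -> (c i).2 (f i)]).
    eexists; eexists; split; last by [].
      by exists D, (fst \o c); split=> // i /cP[].
    by exists D, (snd \o c); split=> // i /cP[].
  move=> [f g] [/= fc gc] i Di; have [_ _ ->] := cP _ Di.
  by split; [exact: fc | exact: gc].
- move=> _ [_ [_ [[D [b [Dlt bb ->]]] [E [c [Elt cc ->]]] ->]]].
  pose b' i := if pselect (D i) then b i else B0.
  pose c' i := if pselect (E i) then c i else C0.
  exists [set f | forall i, (D `|` E) i -> (b' i `*` c' i) (f i)].
    exists (D `|` E), (fun i => b' i `*` c' i); split=> //; first exact: regular_setU.
    move=> i _; exists (b' i), (c' i); split=> //.
      by rewrite /b'; case: pselect => // h; exact: bb.
    by rewrite /c'; case: pselect => // h; exact: cc.
  move=> f fP; split=> /= i hi.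
    by have [+ _] := fP i (or_introl hi); rewrite /b'; case: pselect.
  by have [_ +] := fP i (or_intror hi); rewrite /c'; case: pselect.
Qed.

(** A support in the product is cut into its slices. Conversely, fewer than |K| slices of size below
    |K| are glued together, and regularity keeps the result below |K|. *)
Lemma box_curry (K M N : Type) (X : bspace) : regular_infinite K ->
  feebly_homeomorphic (box K (M * N)%type X) (box K M (box K N X)).
Proof.
move=> Kreg; exists (fun f i j => f (i, j)), (fun g p => g p.1 p.2); split=> //.
- by move=> f; apply: funext => -[].
- move=> _ [D [b [Dlt bb ->]]].
  pose Di i := [set j | D (i, j)].
  exists [set g | forall i, (fst @` D) i -> forall j, Di i j -> b (i, j) (g i j)].
    exists (fst @` D), (fun i => [set h | forall j, Di i j -> b (i, j) (h j)]); split=> //.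
      exact: card_le_lt (card_image_le _ _) Dlt.
    move=> i _; exists (Di i), (fun j => b (i, j)); split=> // [|j /bb//].
    by apply: card_le_lt Dlt; apply: (@card_le_inj _ _ (pair i)) => // j j' _ _ [].
  by move=> g gP [i j] Dij; apply: gP => //; exists (i, j).
- move=> _ [D [b [Dlt bb ->]]].
  have /choice[c cP] : forall i, exists c : set N * (N -> set X), D i ->
      [/\ card_lt c.1 [set: K], forall j, c.1 j -> base (c.2 j) &
          b i = [set h | forall j, c.1 j -> c.2 j (h j)]].
    move=> i; have [/bb[E [d ?]]|nDi] := pselect (D i); first by exists (E, d).
    by exists (set0, fun=> set0) => /nDi.
  pose E := \bigcup_(i in D) [set p : M * N | p.1 = i /\ (c i).1 p.2].
  exists [set f | forall p, E p -> (c p.1).2 p.2 (f p)].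
    exists E, (fun p => (c p.1).2 p.2); split=> //.
      apply: regular_bigcup => // i /cP[clt _ _].
      apply: card_le_lt clt; apply: (@card_le_inj _ _ snd); first by move=> p [].
      by move=> [? ?] [? ?] [/= -> _] [/= -> _] ->.
    by move=> [i j] [i' /cP[_ cb _] [/= -> /cb]].
  move=> f fP i Di; have [_ _ ->] := cP _ Di => j cj.
  by apply: (fP (i, j)); exists i.
Qed.

(** * Box topologies over a discrete space and their nowhere dense sets *)

Lemma base_box_discrete (K M R : Type) (U : set (M -> R)) (r0 : R) :
  @base (box K M (discrete R)) U <-> box_basic K U.
Proof.
split=> [[D [b [Dlt bb ->]]]|[D [s [Dlt ->]]]]; last first.
  by exists D, (fun x => [set s x]); split=> // i _; exists (s i).
have /choice[s sP] : forall i, exists r, D i -> b i = [set r].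
  move=> i; have [/bb[r _ <-]|nDi] := pselect (D i); first by exists r.
  by exists r0 => /nDi.
exists D, s; split=> //; apply/seteqP; split=> f fP x Dx; have := fP x Dx.
  by rewrite sP.
by move=> ->; rewrite sP.
Qed.

(** Two properties of basic sets are used: they are nonempty, and around a common point two of them
    contain a third, since the union of two small supports is small. *)
Lemma box_nowhere_denseE (K M R : Type) (r0 : R) (A : set (M -> R)) :
  regular_infinite K -> box_nowhere_dense K A <-> @nwd (box K M (discrete R)) A.
Proof.
move=> Kreg.
have baseE U := base_box_discrete K U r0.
have basic_ne U : @box_basic M R K U -> exists f, U f.
  by move=> [D [s [_ ->]]]; exists s.
have basic_open U : @box_basic M R K U -> box_open K U by move=> Ub f Uf; exists U; do 2 split=> //.
have basicI U V f : @box_basic M R K U -> box_basic K V -> U f -> V f ->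
    exists W, [/\ box_basic K W, W f & W `<=` U `&` V].
  move=> [D [s [Dlt ->]]] [E [t [Elt ->]]] Uf Vf.
  exists [set g | forall x, (D `|` E) x -> g x = f x]; split=> //.
    by exists (D `|` E), f; split=> //; exact: regular_setU.
  move=> g gf; split=> x hx; first by rewrite gf; [exact: Uf | left].
  by rewrite gf; [exact: Vf | right].
split.
- move=> Anwd B /baseE Bb; have [s Bs] := basic_ne _ Bb.
  (* If [B] lay inside the closure of [A], it would be an open set witnessing a nonempty
     interior. *)
  have [f [Bf ncf]] : exists f, B f /\ ~ box_closure K A f.
    apply: contrapT => nf; have : box_interior K (box_closure K A) s.
      exists B; split; first exact: basic_open.
      by split=> // f Bf; apply: contrapT => ncf; apply: nf; exists f.
    by rewrite Anwd.
  move: ncf => /existsNP[U /not_implyP[Uo /not_implyP[Uf UA]]].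
  have [C [Cb [Cf CU]]] := Uo _ Uf.
  have [W [Wb Wf WBC]] := basicI _ _ _ Bb Cb Bf Cf.
  exists W; first exact/baseE; move=> g /WBC[Bg Cg]; split=> // Ag.
  by apply: UA; exists g; split=> //; exact: CU.
- move=> Anwd; rewrite /box_nowhere_dense -subset0 => f [U [Uo [Uf Ucl]]].
  have [B [/baseE Bb [Bf BU]]] := Uo _ Uf.
  have [B' /baseE B'b B'BA] := Anwd _ Bb; have [s B's] := basic_ne _ B'b.
  have /Ucl/(_ B' (basic_open _ B'b) B's)[g [/B'BA[_ nAg] //]] : U s.
  by apply: BU; exact: (B'BA _ B's).1.
Qed.

(** * The feeble homeomorphism between the two function spaces *)

Lemma box_bool_split (K : Type) : regular_infinite K ->
  feebly_homeomorphic (box K K (discrete bool))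
    (bprod (discrete K) (box K K (discrete bool))).
Proof.
move=> Kreg; have [k0 _] := infinite_setN0 Kreg.1.
have [lt [ltwf lttr ltirr lttot ltsm]] := regular_order Kreg.
have lesm k : card_lt ([set j | lt j k] `|` [set k]) [set: K].
  by apply: regular_setU => //; exact: infinite_card_lt1 Kreg.1.
have /choice[r /choice[s rsP]] : forall k, exists r s : K -> K,
    [/\ forall i, lt k (r i), cancel r s & forall j, lt k j -> r (s j) = j].
  move=> k; have [] := @card_eq_setT _ _ k0 k0 (~` ([set j | lt j k] `|` [set k])).
    by apply: Cantor_Bernstein; [exact: regular_setC | exact: card_leT].
  move=> r [s [rA rs sr]]; exists r, s; split=> //.
    by move=> i; have := rA i; case: (lttot k (r i)) => // [<-|?] []; [right|left].
  by move=> j kj; apply: sr => -[/(lttr _ _ _ kj)/ltirr//|e]; apply: (ltirr k); rewrite -{2}e.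
pose zero : K -> bool := fun=> false.
(* cons k y has its first 1 at k and a copy of y above k; [r k] enumerates the
   points above k, with inverse [s k]. *)
pose cons k (y : K -> bool) j := `[< j = k >] || `[< lt k j >] && y (s k j).
have cons_at k y : cons k y k by rewrite /cons asboolT.
have cons_lt k y j : lt j k -> cons k y j = false.
  move=> jk; rewrite /cons asboolF => [|e]; last by apply: (ltirr k); rewrite -{1}e.
  by rewrite asboolF // => /(lttr _ _ _ jk)/ltirr.
have cons_gt k y j : lt k j -> cons k y j = y (s k j).
  move=> kj; rewrite /cons asboolF => [|e]; last by apply: (ltirr k); rewrite -{2}e.
  by rewrite asboolT.
have cons_r k y i : cons k y (r k i) = y i.
  by have [rlt rs _] := rsP k; rewrite cons_gt // rs.
have cons_inj k y k' y' : cons k y = cons k' y' -> k = k' /\ y = y'.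
  move=> e; have kk' : k = k'.
    case: (lttot k k') => // h; exfalso.
      by have := cons_at k y; rewrite e cons_lt.
    by have := cons_at k' y'; rewrite -e cons_lt.
  by subst k'; split=> //; apply: funext => i; rewrite -(cons_r k y) e cons_r.
have consE k (x : K -> bool) : x k -> (forall j, lt j k -> x j = false) -> x = cons k (x \o r k).
  move=> xk x0; apply: funext => j; case: (lttot j k) => [jk|->|kj].
  - by rewrite cons_lt // x0.
  - by rewrite cons_at.
  - by have [_ _ sr] := rsP k; rewrite cons_gt //= sr.
have cons_ex (x : K -> bool) : x <> zero -> exists k y, x = cons k y.
  move=> nx; have [j xj] : exists j, x j.
    apply: contrapT => nj; apply: nx; apply: funext => j.
    by apply: contra_notF nj => xj; exists j.
  elim: (ltwf j) xj => {}j _ IH xj.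
  have [[i [ij xi]]|ni] := pselect (exists i, lt i j /\ x i); first exact: IH ij xi.
  exists j, (x \o r j); apply: consE => // i ij.
  by apply: contra_notF ni => xi; exists i.
have cons_n0 k y : cons k y <> zero.
  by move=> e; have := cons_at k y; rewrite e.
(* [option K] indexes the sequences with at most one 1: [None] stands for [zero] and [Some k] for
   [cons k zero]. Through [psi] they are matched with the pairs [(a, zero)]. *)
have [psi [phi [psiK phiK]]] : exists (f : K -> option K) g, cancel f g /\ cancel g f.
  apply: card_eqTP; apply: Cantor_Bernstein; last exact: regular_card_option.
  by apply: (@card_le_inj _ _ Some) => // ? ? _ _ [].
pose F (p : K * (K -> bool)) := if `[< p.2 = zero >]
  then (if psi p.1 is Some k then cons k zero else zero) else cons p.1 p.2.
have Fn0 a y : y <> zero -> F (a, y) = cons a y by move=> ny; rewrite /F asboolF.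
have F0 a : F (a, zero) = if psi a is Some k then cons k zero else zero by rewrite /F asboolT.
have Finj : injective F.
  move=> [a y] [a' y']; have [->|ny] := pselect (y = zero); have [->|ny'] := pselect (y' = zero).
  - rewrite !F0 => e; congr (_, _); apply: (can_inj psiK); move: e.
    case: (psi a) (psi a') => [k|] [k'|] //; first by move=> /cons_inj[->].
    + by move=> /cons_n0.
    + by move=> /esym/cons_n0.
  - rewrite F0 Fn0 //; case: (psi a) => [k /cons_inj[_ /esym//]|/esym/cons_n0//].
  - rewrite F0 Fn0 //; case: (psi a') => [k /cons_inj[_ //]|/cons_n0//].
  - by rewrite !Fn0 // => /cons_inj[-> ->].
have /choice[G FG] : forall x, exists p, F p = x.
  move=> x; have [->|/cons_ex[k [y ->]]] := pselect (x = zero).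
    by exists (phi None, zero); rewrite F0 phiK.
  have [->|ny] := pselect (y = zero); last by exists (k, y); rewrite Fn0.
  by exists (phi (Some k), zero); rewrite F0 phiK.
exists G, F; split=> //; first by move=> p; apply: Finj; rewrite FG.
- move=> _ /(base_box_discrete _ _ false)[E [t [Elt ->]]].
  (* Two points outside the support [E] are set to [true], so that [x0] has at least two 1s and its
     tail [y0] is nonzero. *)
  have [e nEe] := card_lt_exN Elt.
  have [e' /not_orP[nEe' /= nee']] : exists e', ~ (E `|` [set e]) e'.
    by apply: card_lt_exN; apply: regular_setU => //; exact: infinite_card_lt1 Kreg.1.
  pose x0 j := if `[< E j >] then t j else true.
  have x0e : x0 e by rewrite /x0 asboolF.
  have x0e' : x0 e' by rewrite /x0 asboolF.
  have [a [y0 x0E]] : exists a y, x0 = cons a y.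
    by apply: cons_ex => e0; move: x0e; rewrite e0.
  have [d y0d] : exists d, y0 d.
    apply: contrapT => nd; have y00 : y0 = zero.
      by apply: funext => j; apply: contra_notF nd => yj; exists j.
    have x0P j : x0 j -> j = a.
      by rewrite x0E y00 /cons /zero andbF orbF => /asboolP.
    by apply: nee'; rewrite (x0P _ x0e) (x0P _ x0e').
  (* Fixing [y] at [d] keeps it nonzero, so [F] acts there as [cons a]. For [j] in [E] not above
     [a], the point [s a j] is arbitrary, and the extra condition does no harm. *)
  pose D := s a @` E `|` [set d].
  exists ([set a] `*` [set y | forall j, D j -> y j = y0 j]).
    exists [set a], [set y | forall j, D j -> y j = y0 j]; split=> //; first by exists a.
    apply/(base_box_discrete _ _ false); exists D, y0; split=> //.
    apply: regular_setU => //; last exact: infinite_card_lt1 Kreg.1.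
    exact: card_le_lt (card_image_le _ _) Elt.
  move=> [_ y] [/= -> yP] j Ej; rewrite Fn0; last first.
    by move=> y0E; have := yP d (or_intror erefl); rewrite y0E y0d.
  have -> : t j = x0 j by rewrite /x0 asboolT.
  by rewrite x0E /cons yP //; left; exists j.
- move=> _ [_ [_ [[a _ <-] /(base_box_discrete _ _ false)[D [t [Dlt ->]]] ->]]].
  have [d nDd] := card_lt_exN Dlt.
  pose y1 j := if `[< D j >] then t j else true.
  (* Prescribing all values up to [a] puts the first 1 exactly at [a]; the value at [r a d] is
     [true] and keeps the tail nonzero, out of the exceptional set. *)
  pose E := ([set j | lt j a] `|` [set a]) `|` r a @` (D `|` [set d]).
  exists [set x | forall j, E j -> x j = cons a y1 j].
    apply/(base_box_discrete _ _ false); exists E, (cons a y1); split=> //.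
    apply: regular_setU => //; apply: card_le_lt (card_image_le _ _) _.
    by apply: regular_setU => //; exact: infinite_card_lt1 Kreg.1.
  move=> x xP.
  have xr i : (D `|` [set d]) i -> x (r a i) = y1 i.
    by move=> hi; rewrite xP ?cons_r //; right; exists i.
  suff -> : x = F (a, x \o r a).
    rewrite /= (_ : G _ = (a, x \o r a)); last by apply: Finj; rewrite FG.
    by split=> //= j Dj; rewrite xr /y1 ?asboolT //; left.
  rewrite Fn0; last first.
    move=> /(congr1 (fun f => f d)); rewrite /= xr /y1 ?asboolF //; by right.
  apply: consE; first by rewrite xP ?cons_at //; left; right.
  by move=> j ja; rewrite xP ?cons_lt //; left; left.
Qed.

Lemma box_bool_feeble (K M : Type) : regular_infinite K -> [set: K] #<= [set: M] ->
  feebly_homeomorphic (box K M (discrete bool)) (box K M (discrete K)).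
Proof.
move=> Kreg KM; have [k0 _] := infinite_setN0 Kreg.1.
have MK : [set: M] #= [set: M * K].
  apply: Cantor_Bernstein; last exact: regular_card_prodr.
  by apply: (@card_le_inj _ _ (fun m => (m, k0))) => // ? ? _ _ [].
have [f [g [fg gf]]] : exists (f : K * bool -> K) g, cancel f g /\ cancel g f.
  apply: card_eqTP; apply: Cantor_Bernstein; first exact: regular_card_prod_bool.
  by apply: (@card_le_inj _ _ (fun k => (k, true))) => // ? ? _ _ [].
have bK : exists B : set (discrete K), base B by exists [set k0], k0.
have b2 : exists B : set (discrete bool), base B by exists [set true], true.
(* Used twice: backwards to expose an inner ^kappa 2 to be split, then forwards to absorb the copy
   that the splitting leaves. *)
have M2 : feebly_homeomorphic (box K M (box K K (discrete bool))) (box K M (discrete bool)).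
  apply: feebly_homeomorphic_trans (feebly_homeomorphic_sym (box_reindex K _ MK)).
  exact/feebly_homeomorphic_sym/box_curry.
apply: feebly_homeomorphic_trans (feebly_homeomorphic_sym M2) _.
apply: feebly_homeomorphic_trans (box_feeble _ _ (box_bool_split Kreg)) _.
apply: feebly_homeomorphic_trans (box_prod _ Kreg bK _) _.
  (* The whole space, as the box with empty support. *)
  exists [set x | forall j, (@set0 K) j -> x j = true].
  apply/(base_box_discrete _ _ true); exists set0, (fun=> true); split=> //.
  exact: infinite_card_lt_finite Kreg.1 (finite_set0 _).
apply: feebly_homeomorphic_trans (bprod_feeble (feebly_homeomorphic_refl _) M2) _.
apply: feebly_homeomorphic_trans (feebly_homeomorphic_sym (box_prod _ Kreg bK b2)) _.
apply: box_feeble; apply: feebly_homeomorphic_trans (discrete_prod _ _) _.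
by exists f, g; exact: discrete_bij.
Qed.

Lemma nowhere_dense_meagre_preimage (K M R S : Type) (f : (M -> R) -> (M -> S)) (A : set (M -> S)) :
  (forall B, box_nowhere_dense K B -> box_nowhere_dense K (f @^-1` B)) ->
  kappa_meagre K A -> kappa_meagre K (f @^-1` A).
Proof.
move=> fP [F [Fle [Fnd ->]]]; exists [set f @^-1` B | B in F]; split.
  exact: card_le_trans (card_image_le _ _) Fle.
by split=> [_ [B /Fnd/fP ? <-]//|]; rewrite preimage_bigcup bigcup_image.
Qed.

(** * Transport of the cardinal characteristics *)

Section Transport.
Context (X Y : Type) (f : X -> Y) (g : Y -> X).
Context (fg : cancel f g) (gf : cancel g f).

Let pull_push (A : set X) : f @^-1` (g @^-1` A) = A.
Proof. by apply/seteqP; split=> x /=; rewrite fg. Qed.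

Let push_pull (A : set Y) : g @^-1` (f @^-1` A) = A.
Proof. by apply/seteqP; split=> x /=; rewrite gf. Qed.

Context (I : set X -> Prop) (J : set Y -> Prop).
Context (JI : forall A, J A -> I (f @^-1` A)) (IJ : forall A, I A -> J (g @^-1` A)).

Let pushI A : J (g @^-1` A) -> I A.
Proof. by move=> /JI; rewrite pull_push. Qed.

Let pullJ A : I (f @^-1` A) -> J A.
Proof. by move=> /IJ; rewrite push_pull. Qed.

Let push_card (F : set (set X)) : [set g @^-1` A | A in F] #= F.
Proof. by apply: inj_card_eq => A B _ _ e; rewrite -(pull_push A) e pull_push. Qed.

Let push_bigcup (F : set (set X)) :
  \bigcup_(B in [set g @^-1` A | A in F]) B = g @^-1` (\bigcup_(A in F) A).
Proof. by rewrite bigcup_image preimage_bigcup. Qed.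

Let pull_bigcup (F : set (set Y)) :
  \bigcup_(B in [set f @^-1` A | A in F]) B = f @^-1` (\bigcup_(A in F) A).
Proof. by rewrite bigcup_image preimage_bigcup. Qed.

Let pull_all (F : set (set Y)) : (forall B, F B -> J B) ->
  forall B, [set f @^-1` A | A in F] B -> I B.
Proof. by move=> FJ _ [B /FJ/JI ? <-]. Qed.

Let push_all (F : set (set X)) : (forall B, F B -> I B) ->
  forall B, [set g @^-1` A | A in F] B -> J B.
Proof. by move=> FI _ [B /FI/IJ ? <-]. Qed.

(** Witnesses are pushed to [Y] by [preimage g], which is injective on sets and so preserves their
    size exactly. Competitors are pulled back by [preimage f], and an image is never larger than its
    source. The characteristics [add] and [cof] follow the same pattern. *)
Lemma is_cov_transport L : is_cov L I -> is_cov L J.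
Proof.
move=> [[C [CL [CI CT]]] Cmin]; split.
  exists [set g @^-1` A | A in C]; split; first exact: card_eq_trans (push_card _) CL.
  by split; [exact: push_all | rewrite push_bigcup CT preimage_setT].
move=> D DJ DT; apply: card_le_trans (card_image_le (preimage f) D).
by apply: Cmin; [exact: pull_all | rewrite pull_bigcup DT preimage_setT].
Qed.

Lemma is_add_transport L : is_add L I -> is_add L J.
Proof.
move=> [[C [CL [CI nC]]] Cmin]; split.
  exists [set g @^-1` A | A in C]; split; first exact: card_eq_trans (push_card _) CL.
  by split; [exact: push_all | rewrite push_bigcup => /pushI].
move=> D DJ nD; apply: card_le_trans (card_image_le (preimage f) D).
by apply: Cmin; [exact: pull_all | rewrite pull_bigcup => /pullJ].
Qed.

Lemma is_non_transport L : is_non L I -> is_non L J.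
Proof.
move=> [[N [NL nN]] Nmin]; split.
  exists (g @^-1` N); split; last by move=> /pushI.
  apply: card_eq_trans NL.
  (* Here the witness is a set of points, whose size is preserved because [f] is injective. *)
  have -> : g @^-1` N = f @` N.
    apply/seteqP; split=> y /=; first by exists (g y).
    by move=> [x Nx <-]; rewrite fg.
  by apply: inj_card_eq => x x' _ _; exact: (can_inj fg).
move=> N' nN'; apply: (@card_le_trans _ _ _ (f @^-1` N')).
  by apply: Nmin => /pullJ.
by apply: (@card_le_inj _ _ f) => // x x' _ _; exact: (can_inj fg).
Qed.

Lemma is_cof_transport L : is_cof L I -> is_cof L J.
Proof.
move=> [[F [FL [FI Fcof]]] Fmin]; split.
  exists [set g @^-1` A | A in F]; split; first exact: card_eq_trans (push_card _) FL.
  split; first exact: push_all.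
  move=> B /JI/Fcof[A FA BA]; exists (g @^-1` A); first by exists A.
  by move=> y By; apply: BA; rewrite /= gf.
move=> D DJ Dcof; apply: card_le_trans (card_image_le (preimage f) D).
apply: Fmin; first exact: pull_all.
move=> A /IJ/Dcof[B DB AB]; exists (f @^-1` B); first by exists B.
by move=> x Ax; apply: AB; rewrite /= fg.
Qed.

End Transport.

(* kappa = |K| regular infinite, mu = |M| singular with cf(mu) = kappa.
   M_kappa(^mu 2, kappa) = @kappa_meagre M bool K,
   M_kappa(^mu kappa, kappa) = @kappa_meagre M K K. *)
Theorem mainTheorem9 (K M : Type) :
  regular_infinite K -> singular_with_cof M K ->
  (forall L : Type, is_cov L (@kappa_meagre M bool K) <-> is_cov L (@kappa_meagre M K K)) /\
  (forall L : Type, is_add L (@kappa_meagre M bool K) <-> is_add L (@kappa_meagre M K K)) /\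
  (forall L : Type, is_non L (@kappa_meagre M bool K) <-> is_non L (@kappa_meagre M K K)) /\
  (forall L : Type, is_cof L (@kappa_meagre M bool K) <-> is_cof L (@kappa_meagre M K K)).
Proof.
move=> Kreg [_ [KM _]]; have [k0 _] := infinite_setN0 Kreg.1.
have [f [g fgP]] := box_bool_feeble Kreg KM; have gfP := feeble_inversesC fgP.
have [fg gf _ _] := fgP.
have JI (A : set (M -> K)) : kappa_meagre K A -> kappa_meagre K (f @^-1` A).
  apply: nowhere_dense_meagre_preimage => B /(box_nowhere_denseE k0 _ Kreg).
  by move=> /(feeble_inverses_nwd fgP)/(box_nowhere_denseE true _ Kreg).
have IJ (A : set (M -> bool)) : kappa_meagre K A -> kappa_meagre K (g @^-1` A).
  apply: nowhere_dense_meagre_preimage => B /(box_nowhere_denseE true _ Kreg).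
  by move=> /(feeble_inverses_nwd gfP)/(box_nowhere_denseE k0 _ Kreg).
(* The two implications of each equivalence differ only by exchanging [f] and [g]. *)
split; [|split; [|split]] => L; split.
- by apply: (@is_cov_transport _ _ f g).
- by apply: (@is_cov_transport _ _ g f).
- by apply: (@is_add_transport _ _ f g).
- by apply: (@is_add_transport _ _ g f).
- by apply: (@is_non_transport _ _ f g).
- by apply: (@is_non_transport _ _ g f).
- by apply: (@is_cof_transport _ _ f g).
- by apply: (@is_cof_transport _ _ g f).
Qed.
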